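(* Let $k\ge2$ be a constant and $K\ge1$. There is a constant $C$ such that every complete $k$-ary tree $G$ with $n$ vertices satisfies $\widetilde{\mathsf{EC}}(G)\le Cn\log n$ for every choice of rotor sequence lengths with $\tilde\kappa\le K$.
   Context: A complete $k$-ary tree is a rooted tree in which every non-leaf vertex has exactly $k$ children and all leaves are at the same depth. Unweighted deterministic walk: each vertex $u$ has a rotor sequence of length $\tilde d(u)$ of neighbours of $u$, each occurring exactly $\tilde d(u)/\deg(u)$ times, and an initial rotor position; $\tilde\kappa=\max_u\tilde d(u)/\deg(u)$. The walk moves from the current vertex to the vertex its rotor points at and then advances that rotor cyclically. $\widetilde{\mathsf{EC}}(G)$ is the maximum over start vertices and all rotor sequences/initial positions (lengths fixed) of the first time every edge has been traversed. (The paper states its bounds for specific graphs under the standing assumption $\tilde\kappa=O(1)$.) *)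

(* Defs.v *)
From mathcomp Require Import all_boot all_order all_algebra.
From mathcomp Require Import classical_sets reals ereal exp.

Set Implicit Arguments.
Unset Strict Implicit.
Unset Printing Implicit Defensive.

Import Order.TTheory GRing.Theory Num.Theory.
Local Open Scope nat_scope.

Definition simple_graph (V : finType) (e : rel V) : Prop :=
  symmetric e /\ irreflexive e.

Definition degree (V : finType) (e : rel V) (u : V) : nat := #|[pred v | e u v]|.

Definition tree (V : finType) (e : rel V) : Prop :=
  [/\ simple_graph e,
      forall x y : V, connect e x y
    & forall c : seq V, 2 < size c -> ~~ ucycleb e c].

Definition walk_of_length (V : finType) (e : rel V) (x y : V) (l : nat) : bool :=
  [exists p : l.-tuple V, path e x p && (last x p == y)].

(* Equals [#|V|] when [y] is not reachable from [x]; otherwise the distance,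
   which is then less than [#|V|]. *)
Definition graph_dist (V : finType) (e : rel V) (x y : V) : nat :=
  find (walk_of_length e x y) (iota 0 #|V|).

Definition children (V : finType) (e : rel V) (r u : V) : {set V} :=
  [set v | e u v && (graph_dist e r v == (graph_dist e r u).+1)].

Definition leaf (V : finType) (e : rel V) (r u : V) : bool :=
  #|children e r u| == 0.

Definition complete_kary_tree (k : nat) (V : finType) (e : rel V) : Prop :=
  tree e /\
  exists r : V,
    (forall u : V, ~~ leaf e r u -> #|children e r u| = k) /\
    (forall u v : V, leaf e r u -> leaf e r v ->
       graph_dist e r u = graph_dist e r v).

(* The lengths for which rotor sequences exist. An isolated vertex (the
   one-vertex tree) has the empty rotor sequence. *)
Definition rotor_lengths (V : finType) (e : rel V) (d : V -> nat) : Prop :=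
  forall u : V, degree e u %| d u /\ (0 < degree e u -> 0 < d u).

(* The quotients are exact for [d] satisfying [rotor_lengths e]. *)
Definition kappa (V : finType) (e : rel V) (d : V -> nat) : nat :=
  \max_(u : V) (d u %/ degree e u).

Definition rotor_sequences (V : finType) (e : rel V) (d : V -> nat)
    (s : V -> seq V) : Prop :=
  forall u : V,
    [/\ size (s u) = d u,
        all (e u) (s u)
      & forall v : V, e u v -> count_mem v (s u) = d u %/ degree e u].

(* For [0 < d u] this says [p u < d u]; an isolated vertex gets the dummy
   position [0]. *)
Definition rotor_positions (V : finType) (d : V -> nat) (p : V -> nat) : Prop :=
  forall u : V, p u <= (d u).-1.

(* A state is the current vertex together with the rotor positions; the default
   value of [nth] only matters at an isolated vertex, where the walk stays. *)
Definition rotor_step (V : finType) (s : V -> seq V) (st : V * (V -> nat)) :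
    V * (V -> nat) :=
  let: (x, p) := st in
  (nth x (s x) (p x), fun u => if u == x then (p x).+1 %% size (s x) else p u).

Definition rotor_walk (V : finType) (s : V -> seq V) (p : V -> nat) (x : V)
    (t : nat) : V :=
  (iter t (rotor_step s) (x, p)).1.

(* Edges are undirected: a traversal in either direction counts. *)
Definition traversed (V : finType) (w : nat -> V) (t : nat) (u v : V) : Prop :=
  exists2 i : nat, i < t &
    (w i = u /\ w i.+1 = v) \/ (w i = v /\ w i.+1 = u).

Definition edges_covered (V : finType) (e : rel V) (w : nat -> V) (t : nat) : Prop :=
  forall u v : V, e u v -> traversed w t u v.

Local Open Scope classical_set_scope.
Local Open Scope ring_scope.

(* [+oo] if some edge is never traversed. *)
Definition edge_cover_time (R : realType) (V : finType) (e : rel V)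
    (w : nat -> V) : \bar R :=
  ereal_inf [set (t%:R)%:E | t in [set t : nat | edges_covered e w t]].

(* The supremum is a maximum, as there are finitely many start vertices, rotor
   sequences and initial positions. *)
Definition EC (R : realType) (V : finType) (e : rel V) (d : V -> nat) : \bar R :=
  ereal_sup [set c : \bar R |
    exists (x : V) (s : V -> seq V) (p : V -> nat),
      [/\ rotor_sequences e d s, rotor_positions d p
        & c = edge_cover_time R e (rotor_walk s p x)]].

(* Main.v *)
(** Write [f u v] for the number of traversals of the arc [u -> v] during the
first [t] steps. Since every edge of a tree is a bridge, [f u v] and [f v u]
differ by at most 1; since the rotor at [u] is cyclic, [f u v] and [f u w]
differ by at most twice the multiplicity at [u]. Hence counts on nearby arcs
are close: if some arc has count 0, every count is at most
[(2 h + 1) (2 kappa + 1)] with [h] the height. As there are at most [2 n]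
arcs, summing bounds [t] by [O(n h)], and [2 ^ h <= n]. *)

Require Import Defs.
From mathcomp Require Import all_boot all_order all_algebra.
From mathcomp Require Import classical_sets reals ereal exp.
From mathcomp Require Import zify ring lra.

Set Implicit Arguments.
Unset Strict Implicit.
Unset Printing Implicit Defensive.

Import Order.TTheory GRing.Theory Num.Theory.
Local Open Scope nat_scope.

(** * Cut vertices and bridges of a tree *)

(** Deletion of [v], encoded on the same type so that [connect] applies: [v] becomes isolated. *)
Definition avoid (V : finType) (e : rel V) (v : V) : rel V :=
  fun x y => [&& e x y, x != v & y != v].

Lemma avoid_connect_sym (V : finType) (e : rel V) (v : V) :
  symmetric e -> connect_sym (avoid e v).
Proof.
move=> sym_e; apply: sym_connect_sym => x y.
by rewrite /avoid sym_e [_ && (y != v)]andbC.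
Qed.

(** A duplicate-free path from [x] to [y] off [v] would close up through [v] to a cycle of at least
    three vertices. *)
Lemma tree_separates (V : finType) (e : rel V) (v x y : V) :
  tree e -> e v x -> e v y -> x != y -> ~~ connect (avoid e v) x y.
Proof.
move=> [[sym_e irr_e] _ acyc] vx vy xy; apply/negP => /connectP [p pp eqy].
move: xy vy; rewrite {y}eqy.
case/shortenP: pp => p' pp' up' _ xl vl.
have vNp' : v \notin p'.
  apply/negP => vp'; move: pp'; case/splitPr: vp' => p1 p2.
  by rewrite cat_path /= {2}/avoid eqxx /= !andbF.
have xv : v != x by apply: contraTneq vx => ->; rewrite irr_e.
have ep' : path e x p' by apply: sub_path pp' => a b /and3P [].
have p'_gt0 : 0 < size p' by case: (p') xl; rewrite //= eqxx.
have := acyc (v :: x :: p') p'_gt0.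
by rewrite /ucycleb cons_uniq up' inE negb_or xv vNp' /= vx rcons_path ep' sym_e vl.
Qed.

(** Take for [A] the component of [u] once [v] is deleted. An edge leaving [A] must end at [v], and
    by [tree_separates] [u] is the only neighbour of [v] in [A]. *)
Lemma tree_bridge (V : finType) (e : rel V) (u v : V) :
  tree e -> e u v ->
  exists A : {set V}, [/\ u \in A, v \notin A &
    forall x y, e x y -> x \in A -> y \notin A -> x = u /\ y = v].
Proof.
move=> tree_e uv; have [[sym_e irr_e] _ _] := tree_e.
have vu : v != u by apply: contraTneq uv => ->; rewrite irr_e.
exists [set x | connect (avoid e v) u x]; split=> [||x y xy].
- by rewrite inE.
- rewrite inE avoid_connect_sym //; apply/negP => /connectP [[|z p] /=].
    by move=> _ E; rewrite E eqxx in vu.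
  by rewrite {1}/avoid eqxx andbF.
rewrite !inE => ux uy.
have xv : x != v.
  apply/eqP => E; move: ux; rewrite E avoid_connect_sym //.
  case/connectP => [[|z p] /=]; first by move=> _ E'; rewrite E' eqxx in vu.
  by rewrite {1}/avoid eqxx andbF.
have yv : y = v.
  apply/eqP; apply: contraNT uy => yv; apply: connect_trans ux _.
  by apply: connect1; rewrite /avoid xy xv yv.
split=> //; apply/esym/eqP; apply: contraTT ux => ux.
by apply: (tree_separates tree_e) => //; rewrite sym_e // -yv.
Qed.

(** * Distances from the root *)

Lemma walk_lengthP (V : finType) (e : rel V) (x y : V) (l : nat) :
  reflect (exists p, [/\ size p = l, path e x p & last x p = y])
          (walk_of_length e x y l).
Proof.
apply: (iffP existsP) => [[p /andP [pp /eqP lp]]|[p [sp pp lp]]].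
  by exists p; rewrite size_tuple.
by move/eqP: sp => sp; exists (Tuple sp); rewrite pp lp eqxx.
Qed.

(** A duplicate-free path has fewer than [#|V|] edges, so the search range of [graph_dist]
    suffices. *)
Lemma graph_dist_has (V : finType) (e : rel V) (x y : V) :
  connect e x y -> has (walk_of_length e x y) (iota 0 #|V|).
Proof.
case/connectP => p pp ->; case/shortenP: pp => q pq uq _.
apply/hasP; exists (size q); last by apply/walk_lengthP; exists q.
by rewrite mem_iota /= add0n -[(size q).+1]/(size (x :: q)) -(card_uniqP uq) max_card.
Qed.

Lemma graph_dist_walk (V : finType) (e : rel V) (x y : V) :
  connect e x y ->
  exists p, [/\ size p = graph_dist e x y, path e x p & last x p = y].
Proof.
move=> /graph_dist_has H; apply/walk_lengthP; have := nth_find 0 H.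
by rewrite nth_iota // -[X in _ < X](size_iota 0 #|V|) -has_find.
Qed.

Lemma graph_dist_le (V : finType) (e : rel V) (x : V) (p : seq V) :
  path e x p -> graph_dist e x (last x p) <= size p.
Proof.
move=> pp; set y := last x p.
have : connect e x y by apply/connectP; exists p.
move/graph_dist_has; rewrite has_find size_iota -/(graph_dist e x y) => lt_n.
rewrite leqNgt; apply/negP => lt_p.
have := before_find 0 lt_p; rewrite nth_iota ?(ltn_trans lt_p) // add0n.
by move=> /negbT/negP; apply; apply/walk_lengthP; exists p.
Qed.

Lemma graph_dist_edge (V : finType) (e : rel V) (r x y : V) :
  connect e r x -> e x y -> graph_dist e r y <= (graph_dist e r x).+1.
Proof.
move=> /graph_dist_walk [p [<- pp lp]] xy.
have := @graph_dist_le _ e r (rcons p y).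
by rewrite rcons_path last_rcons size_rcons lp pp xy; apply.
Qed.

Lemma graph_dist_refl (V : finType) (e : rel V) (r : V) : graph_dist e r r = 0.
Proof. by apply/eqP; rewrite -leqn0; apply: (@graph_dist_le _ e r [::]). Qed.

Lemma graph_dist_pred (V : finType) (e : rel V) (r x : V) :
  connect e r x -> x != r ->
  exists2 y, e y x & graph_dist e r x = (graph_dist e r y).+1.
Proof.
move=> /[dup] crx /graph_dist_walk [p [sp pp lp]] xr.
move: sp pp lp; case/lastP: p => [|p z]; first by move=> _ _ E; rewrite -E eqxx in xr.
rewrite size_rcons rcons_path last_rcons => sp /andP [pp lz] E; subst z.
exists (last r p) => //; apply/eqP; rewrite eqn_leq -{2}sp ltnS graph_dist_le // andbT.
by apply: graph_dist_edge => //; apply/connectP; exists p.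
Qed.

(** * Uniqueness of parents and the number of arcs *)

(** Descend from [x] to the root along predecessors: after [x] all distances are strictly below that
    of [v], so [v] is never met. *)
Lemma avoid_connect_root (V : finType) (e : rel V) (r v x : V) :
  tree e -> x != v -> graph_dist e r x <= graph_dist e r v ->
  connect (avoid e v) r x.
Proof.
move=> [_ conn _]; move En: (graph_dist e r x) => n.
elim: n x En => [|n IH] x dx xv le_xv.
  have [-> //|/(graph_dist_pred (conn r x)) [y _]] := eqVneq x r.
  by rewrite dx.
have [E|/(graph_dist_pred (conn r x)) [y yx]] := eqVneq x r.
  by rewrite E graph_dist_refl in dx.
rewrite dx => -[dy].
have yv : y != v by apply: contraTneq le_xv => E; rewrite dy E ltnn.
apply: connect_trans (IH y _ yv (ltnW le_xv)) _ => //.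
by apply: connect1; rewrite /avoid yx yv xv.
Qed.

(** Both neighbours reach the root off [v], hence are connected off [v], against
    [tree_separates]. *)
Lemma tree_parent_unique (V : finType) (e : rel V) (r v x y : V) :
  tree e -> e v x -> e v y -> graph_dist e r x <= graph_dist e r v ->
  graph_dist e r y <= graph_dist e r v -> x = y.
Proof.
move=> tree_e vx vy le_x le_y; have [[sym_e irr_e] _ _] := tree_e.
have neq z : e v z -> z != v by move=> vz; apply: contraTneq vz => ->; rewrite irr_e.
apply/eqP; apply: contraT => /(tree_separates tree_e vx vy) /negP; case.
apply: (@connect_trans _ _ r); last exact: avoid_connect_root (neq _ vy) _.
rewrite avoid_connect_sym //; exact: avoid_connect_root (neq _ vx) _.
Qed.

Lemma tree_card_parents (V : finType) (e : rel V) (r v : V) :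
  tree e -> \sum_(w | graph_dist e r w <= graph_dist e r v) e v w <= 1.
Proof.
move=> tree_e; rewrite -big_mkcondr sum1_card.
apply/card_le1_eqP => x y; rewrite !unfold_in => /andP [lex vx] /andP [ley vy].
exact: (tree_parent_unique tree_e vy vx ley lex).
Qed.

(** Of an arc and its reverse, at least one does not lead away from the root, and each vertex has at
    most one such outgoing arc. *)
Lemma tree_card_arcs (V : finType) (e : rel V) :
  tree e -> \sum_u \sum_v e u v <= 2 * #|V|.
Proof.
move=> tree_e; have [[sym_e _] conn _] := tree_e.
case: (pickP V) => [r _|V0]; last by rewrite big1 // => u; have := V0 u.
pose lev := graph_dist e r.
pose S := \sum_u \sum_(v | lev v <= lev u) e u v.
have leS : S <= #|V|.
  by rewrite -sum1_card; apply: leq_sum => u _; apply: tree_card_parents.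
apply: (@leq_trans (S + S)); last by rewrite mul2n -addnn leq_add.
(* The second copy of [S] is indexed by heads, so that the two copies dominate the arc count term by
   term. *)
have {2}-> : S = \sum_u \sum_(v | lev u <= lev v) e v u by rewrite /S (exchange_big_dep xpredT).
rewrite /S -big_split /=; apply: leq_sum => u _.
rewrite [X in _ <= X + _]big_mkcond [X in _ <= _ + X]big_mkcond -big_split /=.
apply: leq_sum => v _; rewrite (sym_e v u).
by case: (leqP (lev v)) => [_|/ltnW ->]; rewrite ?leq_addr ?leq_addl.
Qed.

(** * Growth of levels and the height of a complete [k]-ary tree *)

Definition level (V : finType) (e : rel V) (r : V) (i : nat) : {set V} :=
  [set v | graph_dist e r v == i].

(** Double counting of the edges between two consecutive levels: [k] per upper vertex, at most one
    per lower vertex. *)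
Lemma card_level_succ (V : finType) (e : rel V) (r : V) (k i : nat) :
  tree e -> (forall u, u \in level e r i -> #|children e r u| = k) ->
  k * #|level e r i| <= #|level e r i.+1|.
Proof.
move=> tree_e kids; have [[sym_e _] _ _] := tree_e.
rewrite mulnC -sum_nat_const -[X in _ <= X]sum1_card.
have -> : \sum_(u in level e r i) k =
    \sum_(u in level e r i) \sum_(v in level e r i.+1) e u v.
  apply: eq_bigr => u ui; rewrite -(kids u ui) -sum1_card -big_mkcondr.
  by apply: eq_bigl => v; move: ui; rewrite !inE => /eqP ->; rewrite andbC.
rewrite exchange_big; apply: leq_sum => v; rewrite inE => /eqP vi.
apply: leq_trans (tree_card_parents r v tree_e).
rewrite [X in _ <= X]big_mkcond [X in X <= _]big_mkcond; apply: leq_sum => u _.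
by rewrite inE vi; case: eqP => // ->; rewrite leqnSn sym_e.
Qed.

Lemma kary_tree_height (V : finType) (e : rel V) (k : nat) :
  1 < k -> complete_kary_tree k e ->
  exists (r : V) (h : nat),
    (forall v, graph_dist e r v <= h) /\ 2 ^ h <= #|V|.
Proof.
move=> k1 [tree_e [r [kids leaves]]]; exists r.
have [m _ max_m] := arg_maxnP (graph_dist e r) (isT : xpredT r).
have leaf_m : leaf e r m.
  rewrite /leaf cards_eq0; apply/eqP/setP => v; rewrite !inE.
  apply/negbTE; rewrite negb_and; apply/orP; right.
  by rewrite ltn_eqF // ltnS; apply: max_m.
exists (graph_dist e r m); split=> [v|]; first exact: max_m.
(* The deepest vertex [m] is a leaf and all leaves share its depth, so every vertex of smaller depth
   has [k] children. *)
have grow i : i <= graph_dist e r m -> k ^ i <= #|level e r i|.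
  elim: i => [|i IH] lt_i.
    by rewrite card_gt0; apply/set0Pn; exists r; rewrite inE graph_dist_refl.
  rewrite expnS; apply: (@leq_trans (k * #|level e r i|)).
    by rewrite leq_mul2l IH ?orbT // ltnW.
  apply: card_level_succ => // u; rewrite inE => /eqP du; apply: kids.
  by apply: contraTN lt_i => /leaves /(_ leaf_m); rewrite du => ->; rewrite ltnn.
apply: leq_trans (leq_trans (grow _ (leqnn _)) (max_card _)).
by case: (graph_dist e r m) => // j; rewrite leq_exp2r.
Qed.

(** * Traversal counts of arcs *)

(** The count [f u v]; it is directed, unlike [traversed]. *)
Definition crossings (V : finType) (w : nat -> V) (t : nat) (u v : V) : nat :=
  \sum_(i < t) ((w i == u) && (w i.+1 == v)).

Lemma crossings_traversed (V : finType) (w : nat -> V) (t : nat) (u v : V) :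
  0 < crossings w t u v -> traversed w t u v.
Proof.
rewrite lt0n sum_nat_eq0 negb_forall => /existsP [i].
rewrite eqb0 negbK => /andP [/eqP wi /eqP wi1]; exists i => //; by left.
Qed.

Lemma sum_crossings (V : finType) (w : nat -> V) (t : nat) :
  \sum_u \sum_v crossings w t u v = t.
Proof.
rewrite /crossings.
under eq_bigr do rewrite exchange_big.
rewrite exchange_big -[RHS]card_ord -sum1_card; apply: eq_bigr => i _.
rewrite (bigD1 (w i)) //= [X in _ + X]big1 ?addn0; last first.
  by move=> u; rewrite eq_sym => /negPf ->; rewrite big1.
rewrite (bigD1 (w i.+1)) //= !eqxx big1 // => v.
by rewrite eq_sym => /negPf ->; rewrite andbF.
Qed.

Lemma crossings_edge (V : finType) (e : rel V) (w : nat -> V) (t : nat) (u v : V) :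
  (forall i, e (w i) (w i.+1)) -> crossings w t u v = crossings w t u v * e u v.
Proof.
move=> walk_w; rewrite /crossings big_distrl; apply: eq_bigr => i _ /=.
by case: eqP => // <-; case: eqP => // <-; rewrite walk_w.
Qed.

(** The net number of exits from the side [A] of [u] depends only on the sides of [w 0] and [w t],
    so it is at most 1. *)
Lemma crossings_reverse (V : finType) (e : rel V) (w : nat -> V) (t : nat) (u v : V) :
  tree e -> (forall i, e (w i) (w i.+1)) -> e u v ->
  crossings w t u v <= (crossings w t v u).+1.
Proof.
move=> tree_e walk_w uv; have [[sym_e irr_e] _ _] := tree_e.
have [A [uA vA bridge]] := tree_bridge tree_e uv.
(* The walk changes sides only across the bridge [u - v]. *)
have flow : (w 0 \in A) + crossings w t v u = (w t \in A) + crossings w t u v.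
  elim: t => [|t IH]; first by rewrite /crossings !big_ord0.
  rewrite /crossings !big_ord_recr /= -!/(crossings w t _ _).
  suff step : (w t \in A) + ((w t == v) && (w t.+1 == u))
            = (w t.+1 \in A) + ((w t == u) && (w t.+1 == v)).
    by move: IH step; lia.
  case wA: (w t \in A); case wA1: (w t.+1 \in A).
  - rewrite (_ : w t == v = false); last by apply/negbTE; apply: contraNneq vA => <-.
    rewrite (_ : w t.+1 == v = false) ?andbF //.
    by apply/negbTE; apply: contraNneq vA => <-.
  - have [-> ->] := bridge _ _ (walk_w t) wA (negbT wA1); rewrite !eqxx.
    by case: eqP => // E; rewrite -E uA in vA.
  - have wt : e (w t.+1) (w t) by rewrite sym_e.
    have [-> ->] := bridge _ _ wt wA1 (negbT wA); rewrite !eqxx.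
    by case: eqP => // E; rewrite E uA in vA.
  - rewrite (_ : w t == u = false); last first.
      by apply/negbTE; apply: contraTneq uA => <-; rewrite wA.
    rewrite (_ : w t.+1 == u = false) ?andbF //.
    by apply/negbTE; apply: contraTneq uA => <-; rewrite wA1.
by move: flow; case: (_ \in A) => /=; case: (_ \in A) => /=; lia.
Qed.

(* [q] counts the wrap-arounds of the rotor at [u], and does not depend on [v]. *)
Lemma rotor_crossings (V : finType) (s : V -> seq V) (p : V -> nat) (x u : V) (t : nat) :
  (forall y, p y < size (s y)) ->
  exists q, let pos := (iter t (rotor_step s) (x, p)).2 u in
    pos < size (s u) /\
    forall v, crossings (rotor_walk s p x) t u v + count_mem v (take (p u) (s u))
            = q * count_mem v (s u) + count_mem v (take pos (s u)).
Proof.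
move=> lt_p; elim: t => [|t [q]].
  by exists 0; split=> // v; rewrite /crossings big_ord0.
rewrite /crossings; case Est: (iter t (rotor_step s) (x, p)) => [y pt] /= [lt_pt IH].
have wt : rotor_walk s p x t = y by rewrite /rotor_walk Est.
have wt1 : rotor_walk s p x t.+1 = nth y (s y) (pt y).
  by rewrite /rotor_walk iterS Est.
rewrite Est /=; have [E|uy] := eqVneq u y; last first.
  exists q; split=> // v; rewrite -IH big_ord_recr /= wt.
  by rewrite (eq_sym y u) (negPf uy) addn0.
rewrite -E in wt wt1 *.
have step v : \sum_(i < t.+1) ((rotor_walk s p x i == u) && (rotor_walk s p x i.+1 == v))
    + count_mem v (take (p u) (s u))
    = q * count_mem v (s u) + count_mem v (take (pt u).+1 (s u)).
  rewrite big_ord_recr /= wt wt1 eqxx (take_nth u) // -cats1 count_cat /= addn0.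
  by rewrite addnA -IH; lia.
(* At the last position the rotor returns to 0 and the prefix, now the whole sequence, is absorbed
   into [q]; otherwise the position just advances. *)
have := lt_pt; rewrite leq_eqVlt => /orP [/eqP Epos|lt_pt1].
  exists q.+1; rewrite Epos modnn take0; split; first by rewrite -Epos; case: (size _) lt_pt.
  by move=> v; rewrite step Epos take_size /= mulSn; lia.
by exists q; rewrite modn_small.
Qed.

(** The full turns contribute equally to [v] and [w]. What remains are the prefixes at the initial
    and the current position, each worth at most [kappa e d]. *)
Lemma rotor_crossings_le (V : finType) (e : rel V) (d : V -> nat) (s : V -> seq V)
    (p : V -> nat) (x u v w : V) (t : nat) :
  rotor_sequences e d s -> (forall y, p y < size (s y)) -> e u v -> e u w ->
  crossings (rotor_walk s p x) t u v
    <= crossings (rotor_walk s p x) t u w + 2 * kappa e d.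
Proof.
move=> rot lt_p uv uw.
have [q [_ qE]] := rotor_crossings x u t lt_p.
have [_ _ mult] := rot u.
have le_k : d u %/ degree e u <= kappa e d.
  exact: (@leq_bigmax _ (fun u => d u %/ degree e u)).
have le_take y j : e u y -> count_mem y (take j (s u)) <= kappa e d.
  move=> uy; apply: leq_trans le_k; rewrite -(mult y uy).
  by rewrite -{2}(cat_take_drop j (s u)) count_cat leq_addr.
have := qE v; have := qE w; rewrite (mult v uv) (mult w uw).
set pos := (iter _ _ _).2 u; have := le_take v pos uv; have := le_take w (p u) uw.
lia.
Qed.

(** * Propagation along paths and the cover time of a tree *)

(** Each edge of the path costs 1 for reversing an arc and [c] for switching to another arc out of
    the new vertex; switching at [a] costs [c] once more. *)
Lemma crossings_le_distance (V : finType) (e : rel V) (w : nat -> V) (t c : nat)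
    (a b y : V) (l : seq V) :
  tree e -> (forall i, e (w i) (w i.+1)) ->
  (forall u v v', e u v -> e u v' -> crossings w t u v <= crossings w t u v' + c) ->
  e a b -> crossings w t a b = 0 -> path e a l -> e (last a l) y ->
  crossings w t (last a l) y <= (size l).+1 * c.+1.
Proof.
move=> tree_e walk_w rot ab cab; have [[sym_e _] _ _] := tree_e.
elim/last_ind: l y => [|l z IH] y /=.
  by move=> _ ay; have := rot _ _ _ ay ab; rewrite cab; lia.
rewrite rcons_path last_rcons size_rcons => /andP [pl lz] zy.
rewrite sym_e in lz; have := rot _ _ _ zy lz; have := crossings_reverse t tree_e walk_w lz.
by have := IH z pl; rewrite sym_e lz => /(_ isT); lia.
Qed.

Lemma tree_walk_covers (V : finType) (e : rel V) (w : nat -> V) (t c h : nat) (r : V) :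
  tree e -> (forall i, e (w i) (w i.+1)) ->
  (forall u v v', e u v -> e u v' -> crossings w t u v <= crossings w t u v' + c) ->
  (forall v, graph_dist e r v <= h) ->
  2 * #|V| * ((2 * h).+1 * c.+1) < t -> edges_covered e w t.
Proof.
move=> tree_e walk_w rot le_h; have [[sym_e _] conn _] := tree_e.
move=> lt_t a b ab; apply: crossings_traversed; rewrite lt0n.
apply: contraTneq lt_t => cab; rewrite -leqNgt -{1}(sum_crossings w t).
pose M := (2 * h).+1 * c.+1.
have bound u v : crossings w t u v <= e u v * M.
  rewrite (crossings_edge _ _ _ walk_w) mulnC leq_mul2l.
  case uv: (e u v) => //=.
  have [p1 [s1 pp1 l1]] := graph_dist_walk (conn r a).
  have [p2 [s2 pp2 l2]] := graph_dist_walk (conn r u).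
  (* The path from [a] to [u] goes through the root and has at most [2 h] edges; [rev (belast r p1)]
     is the walk [p1] reversed, without its starting vertex [a]. *)
  have pr : path e a (rev (belast r p1)).
    rewrite -l1 rev_path; apply: sub_path pp1 => x y; by rewrite sym_e.
  have lr : last a (rev (belast r p1)) = r.
    by case: (p1) l1 => [/= //|z q _]; rewrite /= rev_cons last_rcons.
  have := @crossings_le_distance _ e w t c a b v (rev (belast r p1) ++ p2).
  rewrite cat_path last_cat lr l2 pr pp2 size_cat size_rev size_belast s1 s2.
  move=> /(_ tree_e walk_w rot ab cab isT uv) le; apply: leq_trans le _.
  by rewrite leq_mul2r ltnS mul2n -addnn leq_add ?orbT.
apply: (@leq_trans (\sum_u \sum_v e u v * M)).
  by apply: leq_sum => u _; apply: leq_sum => v _.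
under eq_bigr do rewrite -big_distrl.
by rewrite -big_distrl leq_mul2r tree_card_arcs ?orbT.
Qed.

Lemma rotor_walk_edge (V : finType) (e : rel V) (d : V -> nat) (s : V -> seq V)
    (p : V -> nat) (x : V) (t : nat) :
  rotor_sequences e d s -> (forall y, p y < size (s y)) ->
  e (rotor_walk s p x t) (rotor_walk s p x t.+1).
Proof.
move=> rot lt_p; rewrite /rotor_walk iterS.
(* The rotor position is in range, so [nth] returns an entry of the sequence and not its default. *)
have [q [+ _]] := rotor_crossings x (iter t (rotor_step s) (x, p)).1 t lt_p.
case: (iter t _ _) => y pt /= lt_pt; have [_ /allP adj _] := rot y.
by apply: adj; apply: mem_nth.
Qed.

Lemma EC_tree_le (R : realType) (V : finType) (e : rel V) (d : V -> nat)
    (r : V) (h : nat) :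
  tree e -> 1 < #|V| -> rotor_lengths e d -> (forall v, graph_dist e r v <= h) ->
  (EC R e d <= ((2 * #|V| * ((2 * h).+1 * (2 * kappa e d).+1)).+1%:R)%:E)%E.
Proof.
move=> tree_e n1 len le_h; have [[sym_e irr_e] conn _] := tree_e.
apply: ge_ereal_sup => _ [x [s [p [rot pos ->]]]].
have lt_p y : p y < size (s y).
  have [-> _ _] := rot y; have [_ d0] := len y.
  (* In a connected graph with two vertices every vertex has a neighbour, so no rotor sequence is
     empty. *)
  have dy : 0 < d y.
    apply: d0; rewrite /degree.
    have [z zy] : exists z, z != y.
      by move: n1; rewrite (cardD1 y) ltnS => /card_gt0P [z /andP [zy _]]; exists z.
    case/connectP: (conn y z) => [[|z' q] /=]; first by move=> _ E; rewrite E eqxx in zy.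
    by move=> /andP [yz' _] _; apply/card_gt0P; exists z'.
  by apply: leq_ltn_trans (pos y) _; rewrite prednK.
(* The witness time is the bound itself; its successor gives the strict inequality that
   [tree_walk_covers] asks for. *)
apply: ereal_inf_lbound; eexists; last reflexivity.
apply: (tree_walk_covers (c := 2 * kappa e d) tree_e _ _ le_h) => //.
- by move=> i; apply: (rotor_walk_edge x i rot lt_p).
- by move=> u v v'; apply: rotor_crossings_le rot lt_p.
Qed.

(** * From the height bound to [n log n] *)

Local Open Scope ring_scope.

Theorem theorem3p17 (R : realType) (k : nat) (K : R)
    (hk : (2 <= k)%N) (hK : 1 <= K) :
  exists C : R,
    forall (V : finType) (e : rel V), complete_kary_tree k e ->
    forall d : V -> nat, rotor_lengths e d -> (kappa e d)%:R <= K ->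
      (EC R e d <= (C * #|V|%:R * ln (#|V|%:R))%:E)%E.
Proof.
have ln2 : 0 < ln 2 :> R by rewrite ln_gt0 ?ltr1n.
(* With [L] the binary logarithm of [n], the time is at most [2 n (3 L) (2 K + 1) + 1], and
   [1 <= n L] absorbs the final 1. *)
exists ((12 * K + 7) / ln 2) => V e kary d len le_K.
have [tree_e _] := kary.
have [r [h [le_h le_n]]] := kary_tree_height hk kary.
(* For a single vertex the right side vanishes as [ln 1 = 0], but there is no edge and time 0
   suffices. *)
have [n1|n1] := ltnP 1 #|V|; last first.
  have nE : #|V| = 1%N by apply/eqP; rewrite eqn_leq n1; apply/card_gt0P; exists r.
  rewrite nE ln1 mulr0; apply: ge_ereal_sup => _ [x [s [p [_ _ ->]]]].
  apply: ereal_inf_lbound; exists 0%N => //= u v uv.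
  have [[_ irr_e] _ _] := tree_e.
  have /card_le1_eqP E : (#|predT : {pred V}| <= 1)%N by rewrite nE.
  by rewrite (E u v) ?irr_e in uv.
apply: le_trans (EC_tree_le R tree_e n1 len le_h) _; rewrite lee_fin.
have n0 : 0 < #|V|%:R :> R by rewrite ltr0n ltnW.
have two0 : 0 < 2 :> R by rewrite ltr0n.
pose L := ln #|V|%:R / ln 2 : R.
have L1 : 1 <= L.
  by rewrite /L ler_pdivlMr // mul1r ler_ln ?posrE // ler_nat.
have Lh : h%:R <= L.
  rewrite /L ler_pdivlMr // mulr_natl -lnXn // ler_ln ?posrE ?exprn_gt0 //.
  by rewrite -natrX ler_nat.
have -> : (12 * K + 7) / ln 2 * #|V|%:R * ln #|V|%:R = (12 * K + 7) * (#|V|%:R * L).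
  by rewrite /L; field; rewrite gt_eqF.
rewrite -addn1 !(natrD, natrM) -[(2 * h).+1]addn1 -[(2 * kappa e d).+1]addn1 !(natrD, natrM).
have n1' : 1 <= #|V|%:R :> R by rewrite ler1n ltnW.
(* The factor 3 comes from [h <= L] together with [1 <= L]. *)
have step : (2 * h%:R + 1) * (2 * (kappa e d)%:R + 1) <= (3 * L) * (2 * K + 1) :> R.
  have h0 : 0 <= h%:R :> R by []; have k0 : 0 <= (kappa e d)%:R :> R by [].
  by apply: ler_pM; lra.
have nL : 1 <= #|V|%:R * L by nra.
have := ler_wpM2l (ltW n0) step.
nra.
Qed.
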